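(* Let each $f_i:\mathbb{R}^d\to\mathbb{R}$ be $L_i$-smooth with $L_i>0$, and put $\bar L=\frac1n\sum_{i=1}^nL_i$. Let $S$ be a group sampling on $[n]$ with $\mathbb{E}[|S|]=\sum_{i=1}^np_i=\tau$ and weights $\theta_S^i=1/p_i$, whose probabilities $p_i=\mathbb{P}[i\in S]$ are chosen such that $\min\{q_i,1\}\le p_i\le1$, where $q_i=L_i\tau/\sum_{j=1}^nL_j$. Then the constant $\mathcal{L}_3$ (defined in the context) satisfies $$\mathcal{L}_3\le\frac{\bar L^2}{\tau}.$$
   Context: $[n]=\{1,\dots,n\}$; $e\in\mathbb{R}^n$ is the all-ones vector. $L$-smooth means differentiable with $L$-Lipschitz gradient; the $f_i$ need not be convex. Group sampling: numbers $p_i\in(0,1]$ are given; $[n]$ is partitioned into groups $C_1,\dots,C_t$ with $\sum_{i\in C_j}p_i\le1$ for every $j$; independently over groups, with probability $\sum_{i\in C_j}p_i$ exactly one index is chosen from $C_j$ (otherwise none), the chosen index being $i\in C_j$ with probability $p_i/\sum_{s\in C_j}p_s$. $S$ is the set of chosen indices, so $\mathbb{P}[i\in S]=p_i$. $\theta_S$ is the diagonal matrix with entries $\theta_S^i$, $\mathbf{I}_S$ is the diagonal $0/1$ indicator matrix of $S$, and $\mathbf{G}(x)=[\nabla f_1(x),\dots,\nabla f_n(x)]$, so $\frac1n\mathbf{G}(x)\theta_S\mathbf{I}_Se=\frac1n\sum_{i\in S}\theta_S^i\nabla f_i(x)$. $\mathcal{L}_3$ is the smallest constant $\ge0$ such that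 for all $x,y\in\mathbb{R}^d$: $\mathbb{E}\left[\|\frac1n(\mathbf{G}(x)-\mathbf{G}(y))\theta_S\mathbf{I}_Se-\frac1n(\mathbf{G}(x)-\mathbf{G}(y))e\|^2\right]\le\mathcal{L}_3\|x-y\|^2$. *)

(* Defs.v *)
From HB Require Import structures.
From mathcomp Require Import all_boot all_order all_algebra.
From mathcomp Require Import all_classical all_reals all_analysis.

Set Implicit Arguments.
Unset Strict Implicit.
Unset Printing Implicit Defensive.

Import Order.TTheory GRing.Theory Num.Theory.
Import numFieldNormedType.Exports.

Local Open Scope classical_set_scope.
Local Open Scope ring_scope.

(* The canonical norm of MathComp-Analysis on matrices is the max norm, hence
   the explicit Euclidean norm; both induce the same notion of differentiable. *)
Definition enorm (R : realType) (d : nat) (x : 'cV[R]_d) : R :=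
  Num.sqrt (\sum_(k < d) x k 0 ^+ 2).

Definition grad (R : realType) (d : nat) (f : 'cV[R]_d -> R) (x : 'cV[R]_d) :
    'cV[R]_d :=
  \col_(k < d) 'D_(delta_mx k 0) f x.

Definition smooth (R : realType) (d : nat) (L : R) (f : 'cV[R]_d -> R) : Prop :=
  (forall x, differentiable f x) /\
  (forall x y, enorm (grad f x - grad f y) <= L * enorm (x - y)).

(* Mutual independence of the family (X i), i in A, of random variables with
   values in a finite (discrete) type: the product rule for all finite
   subfamilies J and all events E i. *)
Definition mutually_independent (dsp : measure_display)
    (T : measurableType dsp) (R : realType) (P : probability T R)
    (I F : finType) (A : {set I}) (X : I -> T -> F) : Prop :=
  forall (J : {set I}) (E : I -> {set F}), J \subset A ->
    P [set w | forall i, i \in J -> X i w \in E i] =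
    (\prod_(i in J) P [set w | X i w \in E i])%E.

(* Group sampling with probabilities p and groups the blocks of C. The random
   index chosen in B, if any, is encoded by the set S w :&: B, which is a
   singleton if an index is chosen and is empty otherwise. *)
Definition group_sampling (dsp : measure_display)
    (T : measurableType dsp) (R : realType) (P : probability T R) (n : nat)
    (p : 'I_n -> R) (C : {set {set 'I_n}}) (S : T -> {set 'I_n}) : Prop :=
  [/\ (forall i, 0 < p i <= 1),
      finset.partition C [set: 'I_n]%SET,
      (forall B, B \in C -> \sum_(i in B) p i <= 1),
      (forall A : {set 'I_n}, measurable [set w | S w = A]) &
      mutually_independent P C (fun B w => S w :&: B) /\
      (forall B, B \in C ->
        [/\ P [set w | #|S w :&: B| = 1%N] = (\sum_(i in B) p i)%:E,
            P [set w | S w :&: B = finset.set0] = (1 - \sum_(i in B) p i)%:E &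
            forall i, i \in B ->
              P [set w | S w :&: B = [set i]%SET] =
              (P [set w | #|S w :&: B| = 1%N]
               * (p i / \sum_(s in B) p s)%:E)%E])].

Definition gradmx (R : realType) (d n : nat) (f : 'I_n -> 'cV[R]_d -> R)
    (x : 'cV[R]_d) : 'M[R]_(d, n) :=
  \matrix_(k < d, i < n) grad (f i) x k 0.

Definition weightmx (R : realType) (n : nat) (theta : 'I_n -> R) : 'M[R]_n :=
  diag_mx (\row_i theta i).

Definition indicmx (R : realType) (n : nat) (S : {set 'I_n}) : 'M[R]_n :=
  diag_mx (\row_i (i \in S)%:R).

Definition L3_admissible (dsp : measure_display) (T : measurableType dsp)
    (R : realType) (P : probability T R) (d n : nat)
    (f : 'I_n -> 'cV[R]_d -> R) (S : T -> {set 'I_n})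
    (theta : {set 'I_n} -> 'I_n -> R) : set R :=
  [set c | 0 <= c /\ forall x y : 'cV[R]_d,
    let D := gradmx f x - gradmx f y in
    let e : 'cV[R]_n := const_mx 1 in
    ('E_P[fun w =>
        (enorm (n%:R^-1 *: (D *m weightmx (theta (S w)) *m indicmx R (S w) *m e)
                - n%:R^-1 *: (D *m e)) ^+ 2)%R]
     <= (c * enorm (x - y) ^+ 2)%:E)%E].

Definition is_L3 (dsp : measure_display) (T : measurableType dsp)
    (R : realType) (P : probability T R) (d n : nat)
    (f : 'I_n -> 'cV[R]_d -> R) (S : T -> {set 'I_n})
    (theta : {set 'I_n} -> 'I_n -> R) (c : R) : Prop :=
  L3_admissible P f S theta c /\ lbound (L3_admissible P f S theta) c.

(* Main.v *)
Require Import Defs.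
From HB Require Import structures.
From mathcomp Require Import all_boot all_order all_algebra.
From mathcomp Require Import all_classical all_reals all_analysis.
From mathcomp Require Import measurable_realfun.
From mathcomp Require Import ring.

Import Order.TTheory GRing.Theory Num.Theory.
Import numFieldNormedType.Exports.

Local Open Scope classical_set_scope.
Local Open Scope ring_scope.

(** Write [a_i := grad f_i x - grad f_i y], so that
    [enorm a_i <= L_i * enorm (x - y)], and
    [c_i := (i \in S) / p_i - 1], a centered random variable. The sampling error
    is [1/n * \sum_i c_i a_i]. In a group sampling two indices of different
    groups are chosen independently and two distinct indices of one group are
    almost never chosen together, hence
    [E (c_i c_j) = (i == j) / p_i - (i and j lie in the same group)]
    ([group_cov]). Expanding the square, the second moment of [\sum_i c_i a_i]
    is [\sum_i enorm a_i ^ 2 / p_i] minus the sum over the groups [B] of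
    [enorm (\sum_(i in B) a_i) ^ 2] ([group_variance]), and the subtracted part
    is nonnegative.

    Moreover [p_i = 1] forces [i \in S], that is [c_i = 0], almost surely: such
    indices can be removed beforehand ([group_variance_le]). For the other
    indices the hypothesis on [p] gives [p_i >= L_i tau / \sum_j L_j], whence
    [enorm a_i ^ 2 / p_i <= L_i * (\sum_j L_j) / tau * enorm (x - y) ^ 2]. Summing
    over [i] and dividing by [n ^ 2] yields the announced constant.

    It remains to see that a least constant exists: the admissible constants
    form a set that is bounded below and closed ([least_L3_exists]).

    Since [S] takes finitely many values, all expectations are finite sums
    weighted by the law of [S] ([expectation_law]). *)

(** * The law of a random variable with values in a finite type *)

(** The probability mass function of [S], as a real-valued function. *)
Definition law {dsp : measure_display} {T : measurableType dsp} {R : realType}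
    (P : probability T R) {F : finType} (S : T -> F) (A : F) : R :=
  fine (P [set w | S w = A]).

Lemma law_ge0 {dsp : measure_display} {T : measurableType dsp} {R : realType}
    (P : probability T R) {F : finType} (S : T -> F) (A : F) : 0 <= law P S A.
Proof. exact: fine_ge0. Qed.

Lemma expectation_law {dsp : measure_display} {T : measurableType dsp}
    {R : realType} (P : probability T R) {F : finType} (S : T -> F)
    (mS : forall A, measurable [set w | S w = A])
    (g : F -> R) (g_ge0 : forall A, 0 <= g A) :
  ('E_P[fun w => g (S w)] = (\sum_A law P S A * g A)%:E)%E.
Proof.
rewrite unlock.
under eq_integral => w _.
  have -> : (g (S w))%:E =
      (\sum_A (g A)%:E * (\1_[set w | S w = A] w)%:E)%E.
    rewrite (bigD1 (S w)) //= indicE mem_set // mule1 big1 ?adde0 // => A neA.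
    rewrite indicE memNset ?mule0 //= => eqA; by rewrite eqA eqxx in neA.
  over.
rewrite ge0_integral_sum //=; last 2 first.
- move=> A; apply: emeasurable_funM; first exact: measurable_cst.
  by apply/measurable_EFinP; apply: measurable_indic; exact: mS.
- by move=> A w _; rewrite -EFinM lee_fin mulr_ge0.
rewrite -sumEFin; apply: eq_bigr => A _.
rewrite ge0_integralZl_EFin //; first last.
- by apply/measurable_EFinP; apply: measurable_indic; exact: mS.
rewrite integral_indic // setIT EFinM muleC /law fineK //.
exact: fin_num_measure.
Qed.

(** The event is a set [E] that needs only be equivalent to [Q (S w)], so that
    propositional events can be counted with a boolean [Q]. *)
Lemma prob_law {dsp : measure_display} {T : measurableType dsp}
    {R : realType} (P : probability T R) {F : finType} (S : T -> F)
    (mS : forall A, measurable [set w | S w = A]) (Q : pred F) (E : set T) :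
  (forall w, E w <-> Q (S w)) -> P E = (\sum_(A | Q A) law P S A)%:E.
Proof.
move=> EQ.
have mE : measurable E.
  rewrite (_ : E = \bigcup_(A in [set A | Q A]) [set w | S w = A]).
    by apply: fin_bigcup_measurable => // A _; exact: mS.
  apply/seteqP; split=> w /=; first by move/EQ => QS; exists (S w).
  by case=> A /= QA SA; apply/EQ; rewrite SA.
rewrite -expectation_indic // (_ : \1_ _ = fun w => (Q (S w))%:R); last first.
  apply/funext => w; rewrite indicE; congr ((nat_of_bool _)%:R).
  by apply/idP/idP; rewrite inE => /EQ.
rewrite (expectation_law P S mS (fun A => (Q A)%:R)) => [|A]; last exact: ler0n.
congr (_%:E); rewrite [RHS]big_mkcond; apply: eq_bigr => A _.
by case: (Q A); rewrite ?mulr1 ?mulr0.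
Qed.

Lemma law_sum1 {dsp : measure_display} {T : measurableType dsp}
    {R : realType} (P : probability T R) {F : finType} (S : T -> F)
    (mS : forall A, measurable [set w | S w = A]) :
  \sum_A law P S A = 1.
Proof.
by apply: EFin_inj; rewrite -(prob_law P S mS predT [set: T]) ?probability_setT.
Qed.

(** * Moments of a group sampling *)

(** Two indices of one group are almost never chosen together: having no index
    and having one index in [B] already exhaust the total mass. *)
Lemma group_law_null {dsp : measure_display} {T : measurableType dsp}
    {R : realType} {P : probability T R} {n : nat} {p : 'I_n -> R}
    {C : {set {set 'I_n}}} {S : T -> {set 'I_n}} (B A : {set 'I_n}) :
  group_sampling P p C S -> B \in C -> (1 < #|A :&: B|)%N -> law P S A = 0.
Proof.
case=> _ _ _ mS [_ /[apply]] [P1 P0 _] gt1.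
have := prob_law P S mS (fun X => #|X :&: B| == 1%N)
  [set w | #|S w :&: B| = 1%N].
rewrite P1 => /(_ (fun w => rwP eqP)) [s1].
have := prob_law P S mS (fun X => X :&: B == finset.set0)
  [set w | S w :&: B = finset.set0].
rewrite P0 => /(_ (fun w => rwP eqP)) [s0].
have := law_sum1 P S mS.
rewrite (bigID (fun X => #|X :&: B| == 1%N)) /= -s1.
rewrite (bigID (fun X => X :&: B == finset.set0)) /=.
rewrite (eq_bigl (fun X => X :&: B == finset.set0)) => [|X]; last first.
  by rewrite andb_idl // => /eqP ->; rewrite cards0.
rewrite -s0 addrA (addrC _ (1 - _)) subrK => /(canRL (addKr _)).
rewrite addNr => /psumr_eq0P; apply; first by move=> *; exact: law_ge0.
by rewrite -cards_eq0 -!leqn0 -!ltnNge; case: #|_| gt1 => [|[|]].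
Qed.

Lemma group_law_marginal {dsp : measure_display} {T : measurableType dsp}
    {R : realType} {P : probability T R} {n : nat} {p : 'I_n -> R}
    {C : {set {set 'I_n}}} {S : T -> {set 'I_n}} (i : 'I_n) :
  group_sampling P p C S -> \sum_(A : {set 'I_n} | i \in A) law P S A = p i.
Proof.
move=> gS; have [p01 Cpart _ mS [_ /(_ (finset.pblock C i))]] := gS.
have iB : i \in finset.pblock C i.
  by rewrite mem_pblock (cover_partition Cpart) finset.in_setT.
have BC : finset.pblock C i \in C.
  by rewrite pblock_mem // (cover_partition Cpart) finset.in_setT.
move=> /(_ BC) [P1 _ /(_ i iB)]; rewrite P1 -EFinM.
have sB_gt0 : 0 < \sum_(s in finset.pblock C i) p s.
  rewrite (bigD1 i) //= ltr_pwDl //; first by case/andP: (p01 i).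
  by apply: sumr_ge0 => s _; case/andP: (p01 s) => /ltW.
rewrite mulrCA mulfV ?gt_eqF // mulr1.
rewrite (prob_law P S mS (fun X => X :&: finset.pblock C i == [set i]%SET));
  last by move=> w; exact: rwP eqP.
move=> [<-]; rewrite big_mkcond [RHS]big_mkcond; apply: eq_bigr => A _.
case: eqP => [AB|AB].
  by have := finset.set11 i; rewrite -AB inE => /andP[-> _].
(* [A] then contains another index of the group of [i], so it has mass 0 *)
case: ifPn => // iA; apply: (group_law_null (finset.pblock C i) _ gS) => //.
rewrite ltn_neqAle card_gt0; apply/andP; split; last first.
  by apply/finset.set0Pn; exists i; rewrite inE iA.
apply: contra_notN AB => /eqP/esym/eqP/cards1P [x ABx].
have : i \in A :&: finset.pblock C i by rewrite inE iA.
by rewrite ABx inE => /eqP ->.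
Qed.

Lemma group_law_pair {dsp : measure_display} {T : measurableType dsp}
    {R : realType} {P : probability T R} {n : nat} {p : 'I_n -> R}
    {C : {set {set 'I_n}}} {S : T -> {set 'I_n}} (i j : 'I_n) :
  group_sampling P p C S ->
  \sum_(A : {set 'I_n} | (i \in A) && (j \in A)) law P S A =
  if finset.pblock C i == finset.pblock C j then (i == j)%:R * p i
  else p i * p j.
Proof.
move=> gS; have [p01 Cpart _ mS [indep _]] := gS.
have iB k : k \in finset.pblock C k.
  by rewrite mem_pblock (cover_partition Cpart) finset.in_setT.
have BC k : finset.pblock C k \in C.
  by rewrite pblock_mem // (cover_partition Cpart) finset.in_setT.
case: eqP => [eqB|/eqP neqB].
  have [<-|neij] := eqVneq i j.
    rewrite mul1r -(group_law_marginal i gS).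
    by apply: eq_bigl => A; rewrite andbb.
  rewrite mul0r big1 // => A /andP[iA jA].
  apply: (group_law_null (finset.pblock C i) _ gS) => //.
  have <- : #|[set i; j]%SET| = 2%N by rewrite cards2 neij.
  apply: subset_leq_card; apply/fintype.subsetP => k; rewrite !inE => /orP[]/eqP->.
    by rewrite iA iB.
  by rewrite jA eqB iB.
(* independence is applied to the two groups, with the events that they give
   [i] and [j] respectively *)
pose E B := [set X : {set 'I_n} |
  (if B == finset.pblock C i then i else j) \in X]%SET.
have /= := indep [set finset.pblock C i; finset.pblock C j]%SET E.
rewrite big_setU1 ?inE // big_set1.
rewrite (prob_law P S mS (fun A => (i \in A) && (j \in A))); last first.
  move=> w; split.
    move=> wE; have := wE (finset.pblock C i); have := wE (finset.pblock C j).
    rewrite !inE !eqxx orbT eq_sym (negbTE neqB).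
    by move=> /(_ isT) /andP[-> _] /(_ isT) /andP[-> _].
  move=> /andP[iw jw] B; rewrite !inE => /orP[]/eqP->.
    by rewrite eqxx iw iB.
  by rewrite eq_sym (negbTE neqB) jw iB.
rewrite (prob_law P S mS (fun A => i \in A)); last first.
  by move=> w; rewrite /= !inE eqxx iB andbT.
rewrite (prob_law P S mS (fun A => j \in A)); last first.
  by move=> w; rewrite /= !inE eq_sym (negbTE neqB) iB andbT.
rewrite !(group_law_marginal _ gS) => indepE; apply: EFin_inj.
rewrite EFinM indepE //.
by apply/fintype.subsetP => B; rewrite !inE => /orP[]/eqP->.
Qed.

(** The quadratic form of the relation of having the same image under [h] is a
    sum of squares, one for each value of [h]. *)
Lemma sum_same_class {R : comNzRingType} {I J : finType} (h : I -> J)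
    (a : I -> R) :
  \sum_i \sum_j (h i == h j)%:R * (a i * a j) =
  \sum_y (\sum_(i | h i == y) a i) ^+ 2.
Proof.
rewrite (partition_big h xpredT) //=; apply: eq_bigr => y _.
rewrite expr2 big_distrlr /=; apply: eq_bigr => i /eqP hi.
rewrite [RHS]big_mkcond /=; apply: eq_bigr => j _.
by rewrite hi eq_sym; case: eqP; rewrite ?mul1r ?mul0r.
Qed.

(** The covariances of the weighted indicators [(i \in S) / p i]. *)
Lemma group_cov {dsp : measure_display} {T : measurableType dsp}
    {R : realType} {P : probability T R} {n : nat} {p : 'I_n -> R}
    {C : {set {set 'I_n}}} {S : T -> {set 'I_n}} (i j : 'I_n) :
  group_sampling P p C S ->
  \sum_(A : {set 'I_n}) law P S A *
    (((i \in A)%:R / p i - 1) * ((j \in A)%:R / p j - 1)) =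
  (i == j)%:R / p i - (finset.pblock C i == finset.pblock C j)%:R.
Proof.
move=> gS; have [p01 _ _ mS _] := gS.
have p_neq0 k : p k != 0 by case/andP: (p01 k) => /gt_eqF ->.
under eq_bigr => A _.
  have -> : law P S A *
      (((i \in A)%:R / p i - 1) * ((j \in A)%:R / p j - 1)) =
    (if (i \in A) && (j \in A) then law P S A else 0) / (p i * p j)
    - (if i \in A then law P S A else 0) / p i
    - (if j \in A then law P S A else 0) / p j
    + law P S A.
    by case: (i \in A); case: (j \in A) => /=; field; rewrite !p_neq0.
  over.
rewrite !big_split /= !sumrN -!mulr_suml -!big_mkcond /=.
rewrite (group_law_pair i j gS) !(group_law_marginal _ gS) (law_sum1 P S mS).
have [<-|neij] := eqVneq i j.
  by rewrite eqxx mulr1n; field.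
by case: eqP => _; rewrite /= ?mulr0n ?mulr1n; field; rewrite !p_neq0.
Qed.

Lemma group_variance {dsp : measure_display} {T : measurableType dsp}
    {R : realType} {P : probability T R} {n : nat} {p : 'I_n -> R}
    {C : {set {set 'I_n}}} {S : T -> {set 'I_n}} (a : 'I_n -> R) :
  group_sampling P p C S ->
  \sum_(A : {set 'I_n}) law P S A *
    (\sum_i a i * ((i \in A)%:R / p i - 1)) ^+ 2 =
  \sum_i a i ^+ 2 / p i -
  \sum_B (\sum_(i | finset.pblock C i == B) a i) ^+ 2.
Proof.
move=> gS; rewrite -sum_same_class -sumrB.
under eq_bigr => A _ do rewrite expr2 big_distrlr mulr_sumr /=.
rewrite exchange_big; apply: eq_bigr => i _ /=.
under eq_bigr => A _ do rewrite mulr_sumr.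
rewrite exchange_big /=.
have -> : a i ^+ 2 / p i = \sum_j (i == j)%:R / p i * (a i * a j).
  rewrite (bigD1 i) //= eqxx big1 => [|j]; last first.
    by rewrite eq_sym => /negbTE ->; rewrite !mul0r.
  by rewrite mulr1n; ring.
rewrite -sumrB; apply: eq_bigr => j _.
rewrite -mulrBl -(group_cov i j gS) mulr_suml; apply: eq_bigr => A _.
by ring.
Qed.

(** An index [i] with [p i = 1] belongs to [S] almost surely and contributes
    nothing to the variance. *)
Lemma group_variance_le {dsp : measure_display} {T : measurableType dsp}
    {R : realType} {P : probability T R} {n : nat} {p : 'I_n -> R}
    {C : {set {set 'I_n}}} {S : T -> {set 'I_n}} (a : 'I_n -> R) :
  group_sampling P p C S ->
  \sum_(A : {set 'I_n}) law P S A *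
    (\sum_i a i * ((i \in A)%:R / p i - 1)) ^+ 2 <=
  \sum_(i | p i != 1) a i ^+ 2 / p i.
Proof.
move=> gS; have [_ _ _ mS _] := gS.
(* the coefficients [a i] with [p i = 1] are replaced by 0 *)
pose b i := if p i != 1 then a i else 0.
have -> : \sum_(i | p i != 1) a i ^+ 2 / p i = \sum_i b i ^+ 2 / p i.
  rewrite big_mkcond; apply: eq_bigr => i _; rewrite /b.
  by case: ifP; rewrite // expr0n mul0r.
have -> : \sum_(A : {set 'I_n}) law P S A *
      (\sum_i a i * ((i \in A)%:R / p i - 1)) ^+ 2 =
    \sum_(A : {set 'I_n}) law P S A *
      (\sum_i b i * ((i \in A)%:R / p i - 1)) ^+ 2.
  apply: eq_bigr => A _.
  have [->|lawA] := eqVneq (law P S A) 0; first by rewrite !mul0r.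
  congr (_ * _ ^+ 2); apply: eq_bigr => i _; rewrite /b.
  case: eqP => // pi1; rewrite pi1 divr1.
  suff -> : i \in A by rewrite subrr !mulr0.
  apply: contraNT lawA => iA; apply/eqP; move: A iA.
  apply: psumr_eq0P => [A _|]; first exact: law_ge0.
  have := law_sum1 P S mS; rewrite (bigID (fun A : {set 'I_n} => i \in A)) /=.
  by rewrite (group_law_marginal i gS) pi1 => /(canRL (addKr _)); rewrite addNr.
rewrite (group_variance b gS) lerBlDr lerDl.
by apply: sumr_ge0 => B _; exact: sqr_ge0.
Qed.

(** * The sampling error *)

Lemma enorm_sqr {R : realType} {d : nat} (x : 'cV[R]_d) :
  enorm x ^+ 2 = \sum_(k < d) x k 0 ^+ 2.
Proof. by rewrite sqr_sqrtr // sumr_ge0 // => k _; exact: sqr_ge0. Qed.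

(** The matrix expression of the sampling error, coordinatewise. *)
Lemma sampling_errorE {R : realType} {d n : nat} (D : 'M[R]_(d, n))
    (p : 'I_n -> R) (A : {set 'I_n}) (k : 'I_d) :
  (n%:R^-1 *: (D *m weightmx (fun i => 1 / p i) *m indicmx R A *m const_mx 1)
   - n%:R^-1 *: (D *m const_mx 1) : 'cV[R]_d) k 0 =
  n%:R^-1 * \sum_i D k i * ((i \in A)%:R / p i - 1).
Proof.
rewrite !mxE -mulrBr -sumrB; congr (_ * _); apply: eq_bigr => i _.
rewrite /weightmx /indicmx !mul_mx_diag !mxE; ring.
Qed.

(** The bound of [group_variance_le] applied to each coordinate, then summed:
    only the norms of the columns of [D] remain. *)
Lemma sampling_error_le {dsp : measure_display} {T : measurableType dsp}
    {R : realType} {P : probability T R} {d n : nat} {p : 'I_n -> R}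
    {C : {set {set 'I_n}}} {S : T -> {set 'I_n}} (D : 'M[R]_(d, n)) :
  group_sampling P p C S ->
  \sum_(A : {set 'I_n}) law P S A *
    enorm (n%:R^-1 *: (D *m weightmx (fun i => 1 / p i) *m indicmx R A
             *m const_mx 1) - n%:R^-1 *: (D *m const_mx 1)) ^+ 2 <=
  n%:R^-1 ^+ 2 * \sum_(i | p i != 1) enorm (col i D) ^+ 2 / p i.
Proof.
move=> gS.
under eq_bigr => A _.
  rewrite enorm_sqr mulr_sumr.
  under eq_bigr => k _ do rewrite sampling_errorE exprMn mulrCA.
  over.
rewrite exchange_big /=.
under eq_bigr => k _ do rewrite -mulr_sumr.
rewrite -mulr_sumr ler_wpM2l ?sqr_ge0 //.
rewrite (le_trans (ler_sum _ (fun k _ => group_variance_le (D k) gS))) //.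
rewrite exchange_big /= ler_sum // => i _.
rewrite -mulr_suml enorm_sqr le_eqVlt; apply/predU1l; congr (_ / _).
by apply: eq_bigr => k _; rewrite mxE.
Qed.

(** * The least constant *)

(** Nothing is assumed on [S] or [theta]: one admissible constant suffices for
    the infimum of all of them to be admissible, since each constraint has the
    form [X <= c * m] with [m >= 0] and [X] extended real. *)
Lemma least_L3_exists {dsp : measure_display} {T : measurableType dsp}
    {R : realType} {P : probability T R} {d n : nat}
    {f : 'I_n -> 'cV[R]_d -> R} {S : T -> {set 'I_n}}
    {theta : {set 'I_n} -> 'I_n -> R} {c0 : R} :
  L3_admissible P f S theta c0 ->
  exists c, is_L3 P f S theta c /\ c <= c0.
Proof.
move=> adm0; set E := L3_admissible P f S theta.
have lbE : has_lbound E by exists 0 => c [].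
exists (inf E); split; last exact: ge_inf.
split; last by move=> c; exact: ge_inf.
split; first by apply: lb_le_inf; [exists c0|move=> c []].
move=> x y /=; set D := gradmx f x - gradmx f y; set e := const_mx 1.
have bound c : E c -> ('E_P[fun w =>
    (enorm (n%:R^-1 *: (D *m weightmx (theta (S w)) *m indicmx R (S w) *m e)
            - n%:R^-1 *: (D *m e)) ^+ 2)%R] <= (c * enorm (x - y) ^+ 2)%:E)%E.
  by case=> _ /(_ x y) /=.
case: ('E_P[_])%E bound => [r||] bound; last by rewrite leNye.
- have := sqr_ge0 (enorm (x - y)); rewrite le_eqVlt => /predU1P[m0|m_gt0].
    by move: (bound _ adm0); rewrite -m0 !mulr0.
  (* for [m > 0], the real [r / m] is a lower bound of the admissible constants *)
  rewrite lee_fin -ler_pdivrMr //; apply: lb_le_inf; first by exists c0.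
  by move=> c /bound; rewrite lee_fin ler_pdivrMr.
- by move: (bound _ adm0).
Qed.

(** * The bound on the least constant *)

Theorem propositionH3 (R : realType) (d n : nat) (n_gt0 : (0 < n)%N)
    (f : 'I_n -> 'cV[R]_d -> R) (L : 'I_n -> R)
    (L_gt0 : forall i, 0 < L i)
    (f_smooth : forall i, smooth (L i) (f i))
    (dsp : measure_display) (T : measurableType dsp) (P : probability T R)
    (p : 'I_n -> R) (C : {set {set 'I_n}}) (S : T -> {set 'I_n})
    (S_group : group_sampling P p C S)
    (tau : R) (tauE : tau = \sum_(i < n) p i)
    (p_bounds : forall i,
      Num.min (L i * tau / \sum_(j < n) L j) 1 <= p i <= 1) :
  exists L3 : R,
    is_L3 P f S (fun _ i => 1 / p i) L3 /\
    L3 <= ((\sum_(i < n) L i) / n%:R) ^+ 2 / tau.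
Proof.
have [p01 _ _ mS _] := S_group.
have p_gt0 i : 0 < p i by case/andP: (p01 i).
have i0 : 'I_n := Ordinal n_gt0.
have sum_gt0 (F : 'I_n -> R) : (forall i, 0 < F i) -> 0 < \sum_(i < n) F i.
  move=> F_gt0; rewrite (bigD1 i0) //= ltr_pwDl //.
  by apply: sumr_ge0 => i _; exact: ltW.
have tau_gt0 : 0 < tau by rewrite tauE sum_gt0.
have sL_gt0 := sum_gt0 L L_gt0; set sL := \sum_(i < n) L i in sL_gt0 *.
apply: least_L3_exists; split; first by rewrite divr_ge0 ?sqr_ge0 ?ltW.
move=> x y /=; set D := gradmx f x - gradmx f y; set e := const_mx 1.
rewrite (expectation_law P S mS (fun A => enorm (n%:R^-1 *:
  (D *m weightmx (fun i => 1 / p i) *m indicmx R A *m e)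
  - n%:R^-1 *: (D *m e)) ^+ 2)) => [|A]; last exact: sqr_ge0.
rewrite lee_fin (le_trans (sampling_error_le D S_group)) //.
set m := enorm (x - y) ^+ 2.
have m_ge0 : 0 <= m by exact: sqr_ge0.
have n_neq0 : n%:R != 0 :> R by rewrite pnatr_eq0 -lt0n.
have -> : (sL / n%:R) ^+ 2 / tau * m =
    n%:R^-1 ^+ 2 * \sum_i L i * (sL / tau * m).
  by rewrite -mulr_suml -/sL; field; rewrite n_neq0 gt_eqF.
rewrite ler_wpM2l ?sqr_ge0 // big_mkcond ler_sum //= => i _.
have Lm_ge0 : 0 <= L i * (sL / tau * m).
  by rewrite (mulr_ge0 (ltW (L_gt0 i))) // mulr_ge0 // divr_ge0 // ltW.
case: ifPn => // pi_neq1.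
have qp : L i * tau / sL <= p i.
  have /andP[] := p_bounds i; rewrite ge_min => /orP[+ _ //|p1 p_le1].
  by move: pi_neq1; rewrite eq_le p_le1 p1.
(* the columns of [D] are the gradient differences, bounded by smoothness *)
have colD : enorm (col i D) ^+ 2 <= L i ^+ 2 * m.
  have -> : col i D = grad (f i) x - grad (f i) y.
    by apply/colP => k; rewrite !mxE.
  rewrite -exprMn lerXn2r ?nnegrE ?sqrtr_ge0 ?mulr_ge0 ?sqrtr_ge0 ?(ltW (L_gt0 i)) //.
  by case: (f_smooth i).
rewrite ler_pdivrMr // (le_trans colD) //.
have -> : L i ^+ 2 * m = L i * (sL / tau * m) * (L i * tau / sL).
  by field; rewrite !gt_eqF.
by rewrite ler_wpM2l.
Qed.
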